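(* Let $R$ be a unital semiprime (associative) ring. Then every element $a \in \operatorname{soc} R$ is unit-regular.
   Context: The right socle of a ring $R$ is the sum of all minimal right ideals of $R$ (equal to $0$ if there are none); the left socle is defined analogously with left ideals. In a semiprime ring the left and right socle coincide, and the common ideal is called the socle and denoted $\operatorname{soc} R$. An element $a \in R$ is called unit-regular if there exists a multiplicatively invertible element $b \in R$ such that $a = aba$. *)

(* Defs.v *)
From HB Require Import structures.
From mathcomp Require Import all_boot all_order all_algebra.
From mathcomp Require Import mathcomp_extra boolp classical_sets.
Set Implicit Arguments.
Unset Strict Implicit.
Unset Printing Implicit Defensive.
Import GRing.Theory.
Local Open Scope classical_set_scope.
Local Open Scope ring_scope.

Definition right_ideal (R : pzRingType) (I : set R) : Prop :=
  [/\ I 0, forall x y, I x -> I y -> I (x - y)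
    & forall x r, I x -> I (x * r)].

Definition left_ideal (R : pzRingType) (I : set R) : Prop :=
  [/\ I 0, forall x y, I x -> I y -> I (x - y)
    & forall x r, I x -> I (r * x)].

Definition two_sided_ideal (R : pzRingType) (I : set R) : Prop :=
  left_ideal I /\ right_ideal I.

(* Finite sums, possibly empty, of elements of S. This is an additive subgroup
   whenever S is closed under opposite, as in all the uses below. *)
Definition finite_sums (R : pzRingType) (S : set R) : set R :=
  [set x | exists s : seq R,
     (forall y, y \in s -> S y) /\ x = \sum_(y <- s) y].

Definition ideal_mul (R : pzRingType) (I J : set R) : set R :=
  finite_sums [set x * y | x in I & y in J].

Definition semiprime (R : pzRingType) : Prop :=
  forall I : set R, two_sided_ideal I ->
    ideal_mul I I = [set 0] -> I = [set 0].

Definition minimal_right_ideal (R : pzRingType) (I : set R) : Prop :=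
  [/\ right_ideal I, I <> [set 0]
    & forall J : set R, right_ideal J -> J `<=` I -> J = [set 0] \/ J = I].

Definition right_socle (R : pzRingType) : set R :=
  finite_sums (\bigcup_(I in [set I : set R | minimal_right_ideal I]) I).

Arguments right_socle : clear implicits.

(* In a semiprime ring, the only case where [socle] is used, the right socle
   is also the sum of all minimal left ideals. *)
Definition socle (R : pzRingType) : set R := right_socle R.

Arguments socle : clear implicits.

(* [GRing.unit] is not available here: a [pzRingType], unlike a
   [unitRingType], may be the zero ring. *)
Definition invertible (R : pzRingType) (b : R) : Prop :=
  exists c : R, b * c = 1 /\ c * b = 1.

Definition unit_regular (R : pzRingType) (a : R) : Prop :=
  exists b : R, invertible b /\ a = a * b * a.

(* Main.v *)
Require Import Defs.
From mathcomp Require Import all_boot all_order all_algebra.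
From mathcomp Require Import mathcomp_extra boolp classical_sets.

(** An element of the socle is a finite sum of atoms, where an atom is an
    element generating a right ideal that is minimal or zero.  The proof is a
    Gaussian elimination whose row operations are left multiplications by
    invertible elements: these preserve unit-regularity
    ([unit_regular_mul_invertible]) and can turn the given element into an
    idempotent.

    At each stage the current element is e + b, where e is an idempotent (the
    part already diagonalised), eb = be = 0, and b is a sum of n atoms.
    If b <> 0, then bR contains a minimal right ideal
    ([sum_of_atoms_atom_multiple]), and semiprimeness gives it an idempotent
    generator f = bt ([atom_idempotent]), which can be corrected to be
    orthogonal to e.  With x = fb and y = (1 - e)tf one gets xy = f, and p = yx
    is another idempotent, with pR isomorphic to fR through left
    multiplication by x.  The heart of the matter is that this isomorphism
    extends to an automorphism of R, that is, to an invertible u with up = x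
    ([unit_intertwining]); equivalently, the complements (1 - p)R and (1 - f)R
    are isomorphic, so that minimal right ideals can be cancelled.
    Multiplying e + b on the left by the inverse v of u gives
    (e + p) + v(1 - f)b, where e + p is again an idempotent orthogonal to the
    rest, and the rest is a sum of n - 1 atoms by an exchange argument
    ([sum_of_atoms_cut]).  Starting from e = 0 this ends with b = 0. *)
Set Implicit Arguments.
Unset Strict Implicit.
Unset Printing Implicit Defensive.
Import GRing.Theory.
Local Open Scope classical_set_scope.
Local Open Scope ring_scope.

(** * Atoms and sums of atoms *)

(** Elementwise form of: the right ideal mR is minimal or zero.  Allowing
    m = 0 makes atoms stable under multiplication on both sides. *)
Definition atom (R : pzRingType) (m : R) : Prop :=
  forall x, m * x <> 0 -> exists y, m * x * y = m.

Lemma atomMl (R : pzRingType) (c m : R) : atom m -> atom (c * m).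
Proof.
move=> mA x cmx; have mx : m * x <> 0 by move=> mx; apply: cmx; rewrite -mulrA mx mulr0.
by have [y mxy] := mA _ mx; exists y; rewrite -2!mulrA (mulrA m) mxy.
Qed.

Lemma atomMr (R : pzRingType) (m d : R) : atom m -> atom (m * d).
Proof.
move=> mA x mdx; have [|y mdxy] := mA (d * x); first by rewrite mulrA.
by exists (y * d); rewrite mulrA -(mulrA m) mdxy.
Qed.

(** Schur's lemma: a nonzero left multiplication is injective on mR. *)
Lemma atom_mul_injective (R : pzRingType) (c m x : R) :
  atom m -> c * m <> 0 -> c * (m * x) = 0 -> m * x = 0.
Proof.
move=> mA cm cmx; apply: contrapT => /mA[y mxy].
by apply: cm; rewrite -mxy mulrA cmx mul0r.
Qed.

Lemma atom_minimal_right_ideal (R : pzRingType) (I : set R) (m : R) :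
  minimal_right_ideal I -> I m -> atom m.
Proof.
move=> [[I0 IB IM] _ Imin] Im x mx.
have [||mxR0|mxRI] := Imin [set z | exists r, z = m * x * r].
- split; first by exists 0; rewrite mulr0.
  + by move=> _ _ [r ->] [s ->]; exists (r - s); rewrite mulrBr.
  + by move=> _ t [r ->]; exists (r * t); rewrite mulrA.
- by move=> _ [r ->]; rewrite -mulrA; apply: IM.
- have : [set 0] (m * x) by rewrite -mxR0; exists 1; rewrite mulr1.
  by move/mx.
- by move: Im; rewrite -mxRI => -[y my]; exists y.
Qed.

Definition sum_of_atoms (R : pzRingType) (n : nat) (a : R) : Prop :=
  exists s : seq R,
    [/\ size s = n, forall y, y \in s -> atom y & a = \sum_(y <- s) y].

Lemma sum_of_atomsMl (R : pzRingType) n (c a : R) :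
  sum_of_atoms n a -> sum_of_atoms n (c * a).
Proof.
move=> [s [ss sA ->]]; exists [seq c * y | y <- s]; split.
- by rewrite size_map.
- by move=> _ /mapP[y ys ->]; apply: atomMl; apply: sA.
- by rewrite big_map mulr_sumr.
Qed.

Lemma sum_of_atomsMr (R : pzRingType) n (a d : R) :
  sum_of_atoms n a -> sum_of_atoms n (a * d).
Proof.
move=> [s [ss sA ->]]; exists [seq y * d | y <- s]; split.
- by rewrite size_map.
- by move=> _ /mapP[y ys ->]; apply: atomMr; apply: sA.
- by rewrite big_map mulr_suml.
Qed.

Lemma sum_of_atoms_socle (R : pzRingType) (a : R) :
  socle R a -> exists n, sum_of_atoms n a.
Proof.
move=> [s [sI ->]]; exists (size s); exists s; split=> // y /sI[I Imin Iy].
exact: atom_minimal_right_ideal Imin Iy.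
Qed.

(** Every nonzero right ideal aR inside the socle contains a minimal one.
    Write a = m + b with m an atom.  If some x satisfies mx = 0 and ax <> 0,
    then ax = bx has fewer terms.  Otherwise the right annihilator of m is
    contained in that of a, and a is itself an atom: any y with mxy = m also
    satisfies axy = a. *)
Lemma sum_of_atoms_atom_multiple (R : pzRingType) n (a : R) :
  sum_of_atoms n a -> a <> 0 -> exists r, a * r <> 0 /\ atom (a * r).
Proof.
elim: n a => [|n IHn] a [[|m s] [//= ss sA ->]].
  by rewrite big_nil.
rewrite big_cons; set b := \sum_(y <- s) y => a0.
have bA : sum_of_atoms n b.
  by exists s; split=> [|y ys|//]; [case: ss | apply: sA; rewrite inE ys orbT].
have mA : atom m by apply: sA; rewrite inE eqxx.
have [[x [ax mx]]|noker] := pselect (exists x, (m + b) * x <> 0 /\ m * x = 0).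
  have abx : (m + b) * x = b * x by rewrite mulrDl mx add0r.
  have [|r [bxr bxrA]] := IHn (b * x) (sum_of_atomsMr x bA).
    by rewrite -abx.
  by exists (x * r); rewrite mulrA abx.
exists 1; rewrite mulr1; split=> // x ax.
have [|y mxy] := mA x; first by move=> mx; apply: noker; exists x.
exists y; apply: contrapT => axy; apply: noker; exists (x * y - 1).
by rewrite !mulrBr !mulr1 !mulrA mxy subrr; split=> // /subr0_eq.
Qed.

(** Exchange argument: f = ar is an idempotent of aR, so some term y of
    the sum has yr <> 0, hence y = yrt for some t.  As left multiplication by
    1 - f kills ar, it expresses (1 - f)y through the other terms. *)
Lemma sum_of_atoms_cut (R : pzRingType) n (a r : R) :
  sum_of_atoms n.+1 a -> a * r <> 0 -> a * r * (a * r) = a * r ->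
  sum_of_atoms n ((1 - a * r) * a).
Proof.
move=> [s [ss sA aE]] ar0 arI.
have [y ys yr] : exists2 y, y \in s & y * r <> 0.
  apply: contrapT => nos; apply: ar0; rewrite aE mulr_suml big_seq big1// => y ys.
  by apply: contrapT => yr; apply: nos; exists y.
have [t yrt] := sA y ys _ yr.
set s' := rem y s.
have aE' : a = y + \sum_(z <- s') z.
  by rewrite aE (perm_big _ (perm_to_rem ys)) big_cons.
have E : sum_of_atoms n (\sum_(z <- s') z).
  by exists s'; split=> [|z /mem_rem/sA//|//]; rewrite size_rem// ss.
suff -> : (1 - a * r) * a = (1 - a * r) * ((\sum_(z <- s') z) * (1 - r * t)).
  by apply: sum_of_atomsMl; apply: sum_of_atomsMr.
set S := \sum_(z <- s') z in aE' *.
suff kE : (1 - a * r) * y = - ((1 - a * r) * (S * r * t)).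
  by rewrite {2}aE' mulrDr kE mulrBr mulr1 mulrBr !mulrA addrC.
have yE : y = (a * r - S * r) * t by rewrite aE' (mulrDl y) addrK.
have f0 : (1 - a * r) * (a * r) = 0 by rewrite mulrBl mul1r arI subrr.
by rewrite {1}yE mulrA mulrBr f0 sub0r mulNr !mulrA.
Qed.

(** * Semiprime rings *)

(** If mRm = 0, then the two-sided ideal generated by m has square zero. *)
Lemma semiprime_mulmm (R : pzRingType) (m : R) :
  semiprime R -> m <> 0 -> exists t, m * t * m <> 0.
Proof.
move=> hR m0; apply: contrapT => nt.
have mtm t : m * t * m = 0 by apply: contrapT => mt; apply: nt; exists t.
pose G : set R := [set z | exists x y, z = x * m * y].
pose I := finite_sums G.
have GI z : G z -> I z.
  by move=> Gz; exists [:: z]; split=> [y|]; rewrite ?big_seq1// inE => /eqP->.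
have I0 : I 0 by exists [::]; rewrite big_nil.
have IB x y : I x -> I y -> I (x - y).
  move=> [s [sG ->]] [t [tG ->]]; exists (s ++ [seq - z | z <- t]); split=> [z|].
    rewrite mem_cat => /orP[/sG//|/mapP[w /tG[u [v ->]] ->]].
    by exists (- u), v; rewrite !mulNr.
  by rewrite big_cat big_map sumrN.
have Iid : two_sided_ideal I.
  split; split=> // _ r [s [sG ->]].
  - exists [seq r * z | z <- s]; split=> [_ /mapP[w /sG[u [v ->]] ->]|].
      by exists (r * u), v; rewrite !mulrA.
    by rewrite big_map mulr_sumr.
  - exists [seq z * r | z <- s]; split=> [_ /mapP[w /sG[u [v ->]] ->]|].
      by exists u, (v * r); rewrite !mulrA.
    by rewrite big_map mulr_suml.
have II x y : I x -> I y -> x * y = 0.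
  move=> [s [sG ->]] [t [tG ->]]; rewrite mulr_suml big_seq big1// => z /sG[u [v ->]].
  rewrite mulr_sumr big_seq big1// => w /tG[u' [v' ->]].
  by rewrite -!mulrA (mulrA v) (mulrA m (v * u')) (mulrA _ m v') mtm mul0r mulr0.
have I2 : ideal_mul I I = [set 0].
  apply/seteqP; split=> [_ [s [sI ->]]|_ ->]; last by exists [::]; rewrite big_nil.
  by rewrite /= big_seq big1// => _ /sI[x Ix [y Iy <-]]; apply: II.
have : I m by apply: GI; exists 1, 1; rewrite mulr1 mul1r.
by rewrite (hR I Iid I2).
Qed.

(** Brauer's lemma.  Since mtm <> 0, left multiplication by mt maps mR
    bijectively onto mtR; the preimage w of mt in mR then satisfies mtw = mt,
    and w * w = w because mt(w * w - w) = 0. *)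
Lemma atom_idempotent (R : pzRingType) (m : R) :
  semiprime R -> atom m -> m <> 0 ->
  exists c, m * c <> 0 /\ m * c * (m * c) = m * c.
Proof.
move=> hR mA m0; have [t mtm] := semiprime_mulmm hR m0.
have [y mty] : exists y, m * t * m * y = m.
  by have [|y] := mA (t * m); rewrite !mulrA//; exists y.
set w := m * (y * t); have zw : m * t * w = m * t by rewrite /w !mulrA mty.
exists (y * t); rewrite -/w; split=> [w0|].
  by apply: mtm; rewrite -zw w0 mulr0 mul0r.
have wE : w * w - w = m * (y * t * w - y * t) by rewrite mulrBr mulrA.
have mt0 : m * t * m <> 0 by [].
apply: subr0_eq; rewrite wE (atom_mul_injective mA mt0)// -wE.
by clearbody w; rewrite mulrBr mulrA !zw subrr.
Qed.

(** * Extending isomorphisms between minimal right ideals *)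

Lemma mulrDD_cross0 (R : pzRingType) (x x' y y' : R) :
  x * y' = 0 -> x' * y = 0 -> (x + x') * (y + y') = x * y + x' * y'.
Proof. by move=> xy' x'y; rewrite mulrDl !mulrDr xy' x'y addr0 add0r. Qed.

(** Under these relations xy and yx are orthogonal idempotents; the element s
    is the involution that exchanges their right ideals and fixes a
    complement of their sum. *)
Lemma swap_square_zero (R : pzRingType) (x y : R) :
  x * x = 0 -> y * y = 0 -> x * y * x = x -> y * x * y = y ->
  let s := x + y + (1 - (x * y + y * x)) in s * s = 1.
Proof.
move=> xx yy xyx yxy /=; set h := x * y + y * x.
have k1 : (x + y) * (x + y) = h by rewrite mulrDl !mulrDr xx yy add0r addr0.
have k2 : (x + y) * h = x + y.
  by rewrite mulrDl !mulrDr !mulrA xx yy xyx yxy !mul0r add0r addr0.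
have k3 : h * (x + y) = x + y.
  by rewrite -k1 -mulrA k1 k2.
have k4 : h * h = h by rewrite -{2}k1 mulrA k3.
move: (x + y) h k1 k2 k3 k4 => z h k1 k2 k3 k4.
have k5 : z * (1 - h) = 0 by rewrite mulrBr mulr1 k2 subrr.
have k6 : (1 - h) * z = 0 by rewrite mulrBl mul1r k3 subrr.
have k7 : (1 - h) * (1 - h) = 1 - h.
  by rewrite mulrBl mul1r mulrBr mulr1 k4 subrr subr0.
by rewrite mulrDD_cross0// k1 k7 addrC subrK.
Qed.

(** The relations say that x and y define mutually inverse isomorphisms between
    the right ideals of the idempotents p = yx and f = xy.  The invertible u
    extends the isomorphism from pR to fR, and its inverse v maps fR back to
    pR through y.  The last clause keeps u trivial on any idempotent that is
    already split off. *)
Definition intertwined (R : pzRingType) (x y : R) : Prop :=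
  exists u v,
    [/\ u * v = 1, v * u = 1, u * (y * x) = x, y * x * v = y
      & forall e, x * e = 0 -> y * e = 0 -> e * x = 0 -> e * y = 0 ->
          u * e = e /\ e * u = e].

Lemma intertwined_square_zero (R : pzRingType) (x y : R) :
  x * x = 0 -> x * y * x = x -> y * x * y = y -> intertwined x y.
Proof.
move=> xx xyx yxy.
(* With p = y * x, replacing y by y' = y * (1 - p) leaves p = y' * x unchanged
   and makes x * y' orthogonal to p, so that an involution s exchanges p and
   x * y'.  As x * y and x * y' generate the same right ideal, they are
   conjugate, by 1 - k with k = x * y * p, and conjugation by 1 - k turns
   x * y' back into x * y. *)
have [y' y'E] : exists y', y' = y * (1 - y * x) by eexists.
have py : (1 - y * x) * y = 0 by rewrite mulrBl yxy mul1r subrr.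
have y'x : y' * x = y * x.
  by rewrite y'E -mulrA mulrBl -(mulrA y) xx mulr0 subr0 mul1r.
have xy'x : x * y' * x = x by rewrite -mulrA y'x mulrA.
have y'xy' : y' * x * y' = y' by rewrite y'x y'E mulrA yxy.
have y'y' : y' * y' = 0 by rewrite y'E mulrA -(mulrA y) py mulr0 mul0r.
have y'p : y' * (y * x) = 0 by rewrite y'E -mulrA (mulrA _ y) py mul0r mulr0.
have := swap_square_zero xx y'y' xy'x y'xy'.
set s := _ + _ => /= ss.
pose k := x * y * y * x.
have kk : k * k = 0 by rewrite /k -!mulrA (mulrA x x) xx mul0r !mulr0.
have k1 : (1 - k) * (1 + k) = 1.
  by rewrite mulrBl mul1r mulrDr mulr1 kk addr0 addrK.
have k2 : (1 + k) * (1 - k) = 1.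
  by rewrite mulrDl mul1r mulrBr mulr1 kk subr0 subrK.
exists ((1 - k) * s), (s * (1 + k)); split.
- by rewrite mulrA -(mulrA _ s s) ss mulr1 k1.
- by rewrite mulrA -(mulrA s (1 + k)) k2 mulr1 ss.
- have sp : s * (y * x) = x.
    rewrite /s !mulrDl mulNr mul1r y'p addr0 mulrDl -(mulrA x y') y'p mulr0.
    by rewrite add0r y'x !mulrA yxy subrr addr0.
  by rewrite -mulrA sp mulrBl mul1r /k -!mulrA xx !mulr0 subr0.
- have ps : y * x * s = y'.
    rewrite /s !mulrDr mulrN mulr1 -(mulrA y x x) xx mulr0 add0r.
    rewrite mulrDr y'x !mulrA yxy -(mulrA y x x) xx mulr0 mul0r add0r subrr addr0.
    by rewrite y'E mulrA yxy.
  rewrite mulrA ps mulrDr mulr1 /k !mulrA y'x yxy y'E mulrBr mulr1.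
  by rewrite !mulrA subrK.
- move=> e xe ye ex ey.
  have y'e : y' * e = 0 by rewrite y'E -mulrA mulrBl mul1r -mulrA xe mulr0 subr0 ye.
  have ey' : e * y' = 0 by rewrite y'E mulrA ey mul0r.
  have se : s * e = e.
    rewrite /s !mulrDl mulNr mul1r mulrDl -!mulrA xe y'e !mulr0.
    by rewrite !addr0 subr0 add0r.
  have es : e * s = e.
    rewrite /s !mulrDr mulrN mulr1 mulrDr !mulrA ex ey' !mul0r.
    by rewrite !addr0 subr0 add0r.
  have ke : k * e = 0 by rewrite /k -!mulrA xe !mulr0.
  have ek : e * k = 0 by rewrite /k !mulrA ex !mul0r.
  split; first by rewrite -mulrA se mulrBl mul1r ke subr0.
  by rewrite mulrA mulrBr mulr1 ek subr0.
Qed.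

(** If x * x <> 0, the right ideals of xy and yx have a common complement. *)
Lemma intertwined_square_neq0 (R : pzRingType) (x y : R) :
  atom x -> x * x <> 0 -> x * y * x = x -> y * x * y = y -> intertwined x y.
Proof.
move=> xA xx xyx yxy.
(* x * x generates the same minimal right ideal as x, so x lies in a group
   with identity d, and d generates the right ideal of x * y and the left ideal
   of y * x. *)
have [z xxz] := xA _ xx.
pose d := x * (z * (y * x)).
have xd : x * d = x by rewrite /d !mulrA xxz xyx.
have dp : d * (y * x) = d by rewrite /d -!mulrA (mulrA x y) xyx.
have pd : y * x * d = y * x by rewrite -mulrA xd.
have fd : x * y * d = d by rewrite /d mulrA xyx.
have dx : d * x = x.
  have dxE : d * x - x = x * (z * (y * x) * x - 1) by rewrite mulrBr mulr1 mulrA.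
  apply: subr0_eq; rewrite dxE (atom_mul_injective xA xx)// -dxE.
  by rewrite mulrBr mulrA xd subrr.
have df : d * (x * y) = x * y by rewrite mulrA dx.
(* (1 - d)R complements both fR and pR, where f = x * y and p = y * x: hence
   1 - d and (1 - f)(1 - p) act as mutually inverse isomorphisms between
   (1 - f)R and (1 - p)R. *)
exists (x + (1 - x * y) * (1 - y * x)), (y + (1 - d)).
have h1 : (1 - y * x) * y = 0 by rewrite mulrBl mul1r yxy subrr.
have h2 : (1 - y * x) * (1 - d) = 1 - d.
  by rewrite mulrBl mul1r mulrBr mulr1 pd subrr subr0.
have h3 : (1 - x * y) * (1 - d) = 1 - x * y.
  by rewrite mulrBr mulr1 mulrBl mul1r fd subrr subr0.
have h4 : y * (1 - x * y) = 0 by rewrite mulrBr mulr1 mulrA yxy subrr.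
have h5 : (1 - d) * (1 - x * y) = 1 - d.
  by rewrite mulrBr mulr1 mulrBl mul1r df subrr subr0.
have h6 : (1 - d) * (1 - y * x) = 1 - y * x.
  by rewrite mulrBl mul1r mulrBr mulr1 dp subrr subr0.
split.
- rewrite mulrDD_cross0; first by rewrite -mulrA h2 h3 addrC subrK.
    by rewrite mulrBr mulr1 xd subrr.
  by rewrite -mulrA h1 mulr0.
- rewrite mulrDD_cross0; first by rewrite mulrA h5 h6 addrC subrK.
    by rewrite mulrA h4 mul0r.
  by rewrite mulrBl mul1r dx subrr.
- have h7 : (1 - y * x) * (y * x) = 0 by rewrite mulrA h1 mul0r.
  by rewrite mulrDl -(mulrA (1 - x * y)) h7 mulr0 addr0 mulrA.
- by rewrite mulrDr yxy mulrBr mulr1 pd subrr addr0.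
- move=> e xe ye ex ey.
  have h7 : (1 - y * x) * e = e by rewrite mulrBl mul1r -mulrA xe mulr0 subr0.
  have h8 : (1 - x * y) * e = e by rewrite mulrBl mul1r -mulrA ye mulr0 subr0.
  have h9 : e * (1 - y * x) = e by rewrite mulrBr mulr1 mulrA ey mul0r subr0.
  have h10 : e * (1 - x * y) = e by rewrite mulrBr mulr1 mulrA ex mul0r subr0.
  by rewrite mulrDl (mulrDr e) xe ex -mulrA h7 h8 mulrA h10 h9 !add0r.
Qed.

Lemma unit_intertwining (R : pzRingType) (x y : R) :
  atom x -> x * y * x = x -> y * x * y = y -> intertwined x y.
Proof.
move=> xA xyx yxy; have [xx|xx] := pselect (x * x = 0).
  exact: intertwined_square_zero.
exact: intertwined_square_neq0.
Qed.

(** * Unit-regularity *)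

Lemma unit_regular_idempotent (R : pzRingType) (e : R) :
  e * e = e -> unit_regular e.
Proof.
by move=> ee; exists 1; split; [exists 1; rewrite mulr1 | rewrite mulr1 ee].
Qed.

Lemma unit_regular_mul_invertible (R : pzRingType) (u v a : R) :
  u * v = 1 -> v * u = 1 -> unit_regular (v * a) -> unit_regular a.
Proof.
move=> uv vu [w [[w' [ww' w'w]] vaE]]; exists (w * v); split.
  exists (u * w'); split; first by rewrite mulrA -(mulrA w) vu mulr1.
  by rewrite mulrA -(mulrA u) w'w mulr1.
by rewrite -[LHS]mul1r -uv -mulrA vaE !mulrA uv mul1r.
Qed.

(** The elimination: one step replaces e by e + p and b by v(1 - f)b, which
    costs one atom. *)
Lemma unit_regular_idempotent_add (R : pzRingType) n (e b : R) :
  semiprime R -> sum_of_atoms n b -> e * e = e -> e * b = 0 -> b * e = 0 ->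
  unit_regular (e + b).
Proof.
move=> hR; elim: n e b => [|n IHn] e b bA ee eb be.
  case: bA => -[|h s] [] // _ _ ->; rewrite big_nil addr0.
  exact: unit_regular_idempotent.
have [->|b0] := eqVneq b 0.
  by rewrite addr0; apply: unit_regular_idempotent.
have [r [br0 brA]] := sum_of_atoms_atom_multiple bA (elimN eqP b0).
have [c [brc0 brcI]] := atom_idempotent hR brA br0.
pose g := b * r * c.
have eg : e * g = 0 by rewrite /g !mulrA eb !mul0r.
(* Multiplying g by 1 - e makes it orthogonal to e on the right as well, and
   keeps its right ideal since e * g = 0. *)
have [f fE] : exists f, f = g * (1 - e) by eexists.
have [t bt] : exists t, b * t = f.
  by exists (r * c * (1 - e)); rewrite fE !mulrA.
have fg : f * g = g by rewrite fE -mulrA mulrBl mul1r eg subr0.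
have ff : f * f = f by rewrite {2 3}fE mulrA fg.
have f0 : f <> 0 by move=> f0; apply: brc0; rewrite -/g -fg f0 mul0r.
have fA : atom f by rewrite fE; do 2 apply: atomMr.
have fe : f * e = 0 by rewrite fE -mulrA mulrBl mul1r ee subrr mulr0.
have ef : e * f = 0 by rewrite fE mulrA eg mul0r.
pose x := f * b; pose y := (1 - e) * t * f.
have by_ : b * y = f by rewrite /y !mulrA mulrBr mulr1 be subr0 bt.
have xy : x * y = f by rewrite /x -mulrA by_.
have yx : y * x = y * b by rewrite /x mulrA /y -(mulrA _ f f) ff.
have xyx : x * y * x = x by rewrite xy /x mulrA ff.
have yxy : y * x * y = y by rewrite -mulrA xy /y -(mulrA _ f f) ff.
have xe : x * e = 0 by rewrite /x -mulrA be mulr0.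
have ye : y * e = 0 by rewrite /y -mulrA fe mulr0.
have ex : e * x = 0 by rewrite /x mulrA ef mul0r.
have ey : e * y = 0 by rewrite /y !mulrA mulrBr mulr1 ee subrr !mul0r.
have [u [v [uv vu up pv /(_ e xe ye ex ey)[ue eu]]]] :=
  unit_intertwining (atomMr fA : atom x) xyx yxy.
have ve : v * e = e by rewrite -{1}ue mulrA vu mul1r.
have ev : e * v = e by rewrite -{1}eu -mulrA uv mulr1.
apply: (unit_regular_mul_invertible uv vu).
have bp : b * (y * x) = x by rewrite mulrA by_ /x mulrA ff.
have -> : v * (e + b) = e + y * x + v * ((1 - f) * b).
  rewrite mulrDr ve -addrA; congr (_ + _).
  by rewrite mulrBl mul1r -/x -{2}up mulrBr mulrA vu mul1r addrC subrK.
have yf : y * f = y by rewrite -{1}xy mulrA.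
apply: IHn.
- by apply: sum_of_atomsMl; rewrite -bt; apply: sum_of_atoms_cut; rewrite ?bt.
- rewrite mulrDD_cross0; first by rewrite ee mulrA yxy.
    by rewrite mulrA ey mul0r.
  by rewrite -mulrA xe mulr0.
- have e0 : e * ((1 - f) * b) = 0.
    by rewrite mulrA mulrBr mulr1 ef subr0 eb.
  have p0 : y * ((1 - f) * b) = 0.
    by rewrite mulrA mulrBr mulr1 yf subrr mul0r.
  by rewrite mulrA mulrDl ev pv mulrDl e0 p0 addr0.
- have x0 : (1 - f) * x = 0 by rewrite mulrBl mul1r /x mulrA ff subrr.
  by rewrite -mulrA -(mulrA (1 - f)) mulrDr be add0r bp x0 mulr0.
Qed.

Theorem theorem4p10 (R : pzRingType) (hR : semiprime R) (a : R)
  (ha : socle R a) : unit_regular a.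
Proof.
have [n aA] := sum_of_atoms_socle ha.
rewrite -(add0r a).
by apply: (unit_regular_idempotent_add hR aA); rewrite ?(mul0r, mulr0).
Qed.
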